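(* Let $f:X\to X$ be a homeomorphism of a compact metric space $X$. If the set of expansive measures of $f$ is dense in $\mathcal{M}(X)$, then $X$ has no isolated points and the set of heteroclinic points of $f$ has no interior points.
   Context: Let $(X,d)$ be a compact metric space and $f:X\to X$ a homeomorphism. $\mathcal{M}(X)$ denotes the set of all Borel probability measures of $X$, with the weak* topology: $\mu_n\to\mu$ if and only if $\int\phi\, d\mu_n\to\int\phi\, d\mu$ for every continuous $\phi:X\to\mathbb{R}$. For $x\in X$ and $\delta\ge 0$ put $\Gamma_\delta(x)=\{y\in X: d(f^i(x),f^i(y))\leq\delta \text{ for every } i\in\mathbb{Z}\}$. A measure $\mu\in\mathcal{M}(X)$ is expansive (for $f$) if there is $\delta>0$ such that $\mu(\Gamma_\delta(x))=0$ for every $x\in X$. A point $x\in X$ is periodic if $f^n(x)=x$ for some integer $n\geq 1$; the orbit $\{f^i(x): i\in\mathbb{Z}\}$ of a periodic point $x$ is called a periodic orbit. The $\omega$-limit set of $x$ is $\omega(x)=\{y\in X: y=\lim_{k\to\infty} f^{n_k}(x) \text{ for some sequence } n_k\to\infty\}$, and the $\alpha$-limit set $\alpha(x)$ is the $\omega$-limit set of $x$ with respect to $f^{-1}$. A heteroclinic point is a point $x$ such that $\alpha(x)$ and $\omega(x)$ are both periodic orbits. *)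

(* Defs.v *)
From HB Require Import structures.
From mathcomp Require Import all_boot all_order all_algebra.
From mathcomp Require Import all_classical all_reals all_analysis.
Set Implicit Arguments.
Unset Strict Implicit.
Unset Printing Implicit Defensive.
Import Order.TTheory GRing.Theory Num.Theory numFieldNormedType.Exports.
Local Open Scope classical_set_scope.
Local Open Scope ring_scope.

(* The library's measurable types are pointed, hence so are the metric spaces
   on which Borel measures are considered. *)
#[short(type="pmetricType")]
HB.structure Definition PointedMetric (K : numDomainType) :=
  {M of Metric K M & Pointed M}.

Record homeo (X : topologicalType) := Homeo {
  homeo_fun :> X -> X;
  homeo_inv : X -> X;
  homeo_funK : cancel homeo_fun homeo_inv;
  homeo_invK : cancel homeo_inv homeo_fun;
  homeo_fun_continuous : continuous homeo_fun;
  homeo_inv_continuous : continuous homeo_inv }.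

Definition ziter (X : topologicalType) (f : homeo X) (i : int) : X -> X :=
  match i with
  | Posz n => iter n f
  | Negz n => iter n.+1 (homeo_inv f)
  end.

Section measures.
Context {R : realType} (X : pmetricType R).

Definition borel := g_sigma_algebraType (@open X).

Definition test_integral (mu : probability borel R) :
    {ptws (continuousType X R) -> R} :=
  fun phi => \int[mu]_x phi x.

(* Borel probability measures with the weak* topology: the coarsest topology
   making mu |-> \int phi dmu continuous for every continuous phi : X -> R. *)
Definition prob_measures : topologicalType := initial_topology test_integral.

End measures.

Section dynamics.
Context {R : realType} {X : pmetricType R}.
Implicit Types (f : homeo X) (x : X) (A : set X).

Definition Gamma f (delta : R) x : set X :=
  [set y | forall i : int, mdist (ziter f i x) (ziter f i y) <= delta].

Definition expansive f (mu : probability (borel X) R) : Prop :=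
  exists2 delta : R, 0 < delta & forall x, mu (Gamma f delta x) = 0%E.

Definition periodic f x : Prop := exists2 n : nat, (0 < n)%N & iter n f x = x.

Definition orbit f x : set X := [set ziter f i x | i in [set: int]].

Definition periodic_orbit f A : Prop :=
  exists2 p, periodic f p & A = orbit f p.

Definition omega_limit (g : X -> X) x : set X :=
  [set y | exists2 n_ : nat -> nat,
     n_ @ \oo --> \oo & iter (n_ k) g x @[k --> \oo] --> y].

Definition alpha_limit f x : set X := omega_limit (homeo_inv f) x.

Definition heteroclinic f : set X :=
  [set x | periodic_orbit f (alpha_limit f x) /\
           periodic_orbit f (omega_limit f x)].

End dynamics.

(* Main.v *)
Require Import Defs.
From mathcomp Require Import all_boot all_order all_algebra.
From mathcomp Require Import all_classical all_reals all_analysis.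
From mathcomp Require Import finmap measurable_realfun lra.
Set Implicit Arguments.
Unset Strict Implicit.
Unset Printing Implicit Defensive.
Import Order.TTheory GRing.Theory Num.Theory numFieldNormedType.Exports.
Local Open Scope classical_set_scope.
Local Open Scope ring_scope.

(* An expansive measure mu gives mass 0 to the heteroclinic points.  If the
   omega-limit set of x is a periodic orbit of period n, then f^(n k)(x)
   converges as k -> oo, and likewise backwards.  Cover X by finitely many open
   sets on which f, ..., f^(n-1) vary by at most delta; a convergent sequence
   f^(n k)(x) visits them along an eventually constant itinerary, and there are
   only countably many of those.  Two points with the same forward and backward
   itineraries lie in each other's Gamma_delta, so the heteroclinic points are
   covered by countably many mu-null sets.  On the other hand density, tested
   near a Dirac mass against a bump function, yields for each nonempty open set
   an expansive measure that charges it. *)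

(** * Convergence along multiples of the period *)

Lemma iter_continuous (T : topologicalType) (h : T -> T) (n : nat) :
  continuous h -> continuous (iter n h).
Proof.
move=> ch; elim: n => [|n IH] y /=; first exact: cvg_id.
by apply: continuous_comp; [exact: IH|exact: ch].
Qed.

Lemma mdist_continuous (R : realType) (X : metricType R) (x : X) :
  continuous (mdist x : X -> R).
Proof.
move=> y; apply/cvgrPdist_lt => e e0.
near=> z; rewrite ltr_distlC; have : mdist y z < e.
  near: z; have := nbhsx_ballx y e e0; rewrite ballEmdist; exact.
have := metric_triangle x y z; have := metric_triangle x z y.
rewrite (metric_sym z y); lra.
Unshelve. all: by end_near. Qed.

Lemma frequently_subsequence (R : realType) (X : metricType R) (z : nat -> X)
    (C : set X) :
  compact C -> (forall K, exists2 k, (K <= k)%N & C (z k)) ->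
  exists2 y, C y & exists2 n_ : nat -> nat,
    n_ @ \oo --> \oo & z (n_ k) @[k --> \oo] --> y.
Proof.
move=> cC zC.
have /choice[m mP] : forall k, exists j, (k <= j)%N /\ C (z j).
  by move=> k; have [j kj zj] := zC k; exists j.
have [|y [Cy cy]] := cC ((z \o m) @ \oo) _.
  by exists 0%N => // k _; exact: (mP k).2.
have /choice[j jP] : forall k : nat, exists j,
    (k <= j)%N /\ mdist y (z (m j)) < k.+1%:R^-1.
  move=> k; have [||_ [[j kj <-] yj]] :=
      cy [set z (m j) | j in [set j | (k <= j)%N]] (ball y k.+1%:R^-1).
  - by exists k => // j kj; exists j.
  - by apply: nbhsx_ballx; rewrite invr_gt0.
  - by exists j; split => //; move: yj; rewrite ballEmdist.
exists y => //; exists (m \o j).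
  apply/cvgnyPge => A; near=> k.
  have kA : (A <= k)%N by near: k; exact: nbhs_infty_ge.
  exact/(leq_trans kA)/(leq_trans (jP k).1)/(mP _).1.
apply/metricType_numDomainType.cvgrPdist_lt => e e0; near=> k.
rewrite /= (lt_trans (jP k).2)//.
by near: k; exact: near_infty_natSinv_lt (PosNum e0).
Unshelve. all: by end_near. Qed.

(** Limit points of [z] lie in the finite set [W], so each is isolated in [W] and fixed by
    [iter n h]. A point of [z] close to such a [q] has its successor still near [q], which traps the
    sequence. *)
Lemma finite_omega_limit_cvg (R : realType) (X : pmetricType R) (h : X -> X)
    (x : X) (n : nat) (W : set X) :
  compact [set: X] -> continuous h -> (0 < n)%N -> finite_set W ->
  (forall w, W w -> iter n h w = w) -> omega_limit h x `<=` W ->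
  exists q : X, iter (n * k) h x @[k --> \oo] --> q.
Proof.
move=> cptX ch n0 fW hW omW.
pose z k := iter (n * k) h x.
(* A closed set that [z] visits at arbitrarily late times contains a cluster point of [z], and this
   point lies in [W]. *)
have zW (C : set X) : closed C -> (forall K, exists2 k, (K <= k)%N & C (z k)) ->
    exists y, [/\ C y, W y &
      forall e K, 0 < e -> exists2 k, (K <= k)%N & mdist y (z k) < e].
  move=> /subclosed_compact/(_ cptX (@subsetT _ C)) cC.
  move=> /(frequently_subsequence cC)[y Cy [n_ n_y zy]].
  exists y; split => //; last first.
    move=> e K /(metricType_numDomainType.cvgr_dist_lt zy) ye.
    have /cvgnyPge/(_ K) Kn := n_y.
    have [k [ke Kk]] := filter_ex (filterI ye Kn).
    by exists (n_ k).
  apply: omW; exists (fun k => n * n_ k)%N => //.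
  apply/cvgnyPge => A; move/cvgnyPge : n_y => /(_ A).
  by apply: filterS => k Ak; rewrite (leq_trans Ak)// leq_pmull.
have zS k : z k.+1 = iter n h (z k) by rewrite /z mulnS iterD.
have cg : continuous (iter n h) by exact: iter_continuous.
have [|q [_ Wq qz]] := zW setT closedT; first by move=> K; exists K.
have fin_closed (A : set X) : finite_set A -> closed A.
  move: A; apply/accessible_finite_set_closed.
  exact/hausdorff_accessible/metric_hausdorff.
have [r r0 Wr] : exists2 r : R, 0 < r & forall w, W w -> mdist q w < r -> w = q.
  have /fin_closed/closed_openC oW : finite_set (W `\ q) by exact: finite_setD.
  have /open_nbhs_nbhs/nbhs_ballP[r /= r0 rW] : open_nbhs q (~` (W `\ q)).
    by split => // -[_ /=].
  exists r => // w Ww qw; apply: contrapT => wq.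
  by apply: (rW w); [rewrite ballEmdist|split].
exists q.
apply/metricType_numDomainType.cvgrPdist_lt => e0 e00.
(* Halving [r] puts [e] strictly below it, so [q] is the only point of [W] at distance at most [e]
   from [q]. *)
pose e := Num.min e0 (r / 2).
have e_gt0 : 0 < e by rewrite lt_min e00 divr_gt0.
have er : e < r by rewrite gt_min ltr_pdivrMr// mulr_natr mulr2n ltrDl r0 orbT.
have ee0 : e <= e0 by rewrite ge_min lexx.
have gq : iter n h q = q by exact: hW.
have /nbhs_ballP[d /= d0 dP] : nbhs q [set y | mdist q (iter n h y) < e].
  have /metricType_numDomainType.cvgrPdist_lt/(_ _ e_gt0) := cg q.
  by rewrite gq.
pose d1 := Num.min d e.
have d1_gt0 : 0 < d1 by rewrite lt_min d0.
(* The closed annulus d1 <= d(q, .) <= e contains no limit point of z, and h^n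
   maps the d1-ball into the e-ball: z, once near q, can never leave. *)
have [K KP] : exists K, forall k, (K <= k)%N ->
    mdist q (z k) <= e -> mdist q (z k) < d1.
  apply: contrapT => /forallNP nK.
  have [||y [/= + Wy _]] := zW (mdist q @^-1` `[d1, e]).
  - apply: (continuous_closedP _).1; last exact: interval_closed.
    exact: mdist_continuous.
  - move=> K; have /existsNP[k /not_implyP[Kk /not_implyP[ke /negP]]] := nK K.
    by rewrite -leNgt => d1k; exists k; rewrite //= in_itv/= d1k.
  - rewrite in_itv/= => /andP[d1y ye].
    have yq : y = q by apply: Wr => //; exact: le_lt_trans er.
    by move: d1y; rewrite yq mdistxx leNgt d1_gt0.
have [k0 Kk0 zk0] : exists2 k, (K <= k)%N & mdist q (z k) < d1.
  exact: qz.
suff zk k : (k0 <= k)%N -> mdist q (z k) < d1.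
  near=> k; apply: (lt_le_trans _ ee0); apply: (lt_le_trans (zk k _)).
    by near: k; exact: nbhs_infty_ge.
  by rewrite ge_min lexx orbT.
elim: k => [|k IH]; first by rewrite leqn0 => /eqP <-.
rewrite leq_eqVlt => /predU1P[<-//|]; rewrite ltnS => k0k.
apply: KP; first by rewrite (leq_trans Kk0)// ltnW.
rewrite zS; apply/ltW/dP; rewrite ballEmdist/= (lt_le_trans (IH k0k))//.
by rewrite ge_min lexx.
Unshelve. all: by end_near. Qed.

(** * Itineraries and countable covers *)

Lemma finite_small_cover (R : realType) (X : pmetricType R) (h : X -> X)
    (delta : R) (n : nat) :
  compact [set: X] -> continuous h -> 0 < delta ->
  exists s : seq (set X),
    (forall y, exists i, open_nbhs y (nth set0 s i)) /\
    (forall i y y' r, nth set0 s i y -> nth set0 s i y' -> (r < n)%N ->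
      mdist (iter r h y) (iter r h y') <= delta).
Proof.
move=> cptX ch delta0.
(* The radius is [delta / 2] because two points of one set are compared through its centre. *)
pose B (m : nat) y : set X :=
  [set z | forall r, (r < m)%N -> mdist (iter r h y) (iter r h z) < delta / 2].
have nB m y : nbhs y (B m y).
  elim: m => [|m IH] /=; first by near=> z.
  have : \forall z \near y, mdist (iter m h y) (iter m h z) < delta / 2.
    have /metricType_numDomainType.cvgrPdist_lt := @iter_continuous _ _ m ch y.
    by apply; rewrite divr_gt0.
  apply: filterS2 IH => z IH zn r.
  by rewrite ltnS leq_eqVlt => /predU1P[->|/IH].
move: cptX; rewrite compact_cover => /(_ _ setT (fun y => interior (B n y))).
case=> [y _|y _|D _ DX].
- exact: open_interior.
- by exists y => //; exact: nbhs_singleton (nbhs_interior (nB n y)).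
exists [seq interior (B n y) | y <- enum_fset D]; split=> [y|i y y' r].
  have [c /= cD cy] := DX y Logic.I.
  exists (index c (enum_fset D)); rewrite (nth_map c) ?index_mem// nth_index//.
  by split => //; exact: open_interior.
(* Past the end of the list [nth] returns [set0], and the claim is vacuous. *)
have [iD|iD] := ltnP i (size (enum_fset D)); last first.
  by rewrite nth_default ?size_map.
case: (enum_fset D) iD => // c0 s iD; rewrite (nth_map c0)//.
move=> /interior_subset yB /interior_subset y'B rn.
set c := nth _ _ _ in yB y'B.
have := metric_triangle (iter r h y) (iter r h c) (iter r h y').
rewrite (metric_sym (iter r h y) (iter r h c)).
have := yB r rn; have := y'B r rn; lra.
Unshelve. all: by end_near. Qed.

(** The period [n] is part of the code, so one sequence of sets serves all periods. *)
Lemma asymptotic_countable_cover (R : realType) (X : pmetricType R)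
    (h : X -> X) (delta : R) :
  compact [set: X] -> continuous h -> 0 < delta ->
  exists A : nat -> set X,
    (forall x n, (0 < n)%N ->
      (exists q : X, iter (n * k) h x @[k --> \oo] --> q) ->
      exists c, A c x) /\
    (forall c x y j, A c x -> A c y ->
      mdist (iter j h x) (iter j h y) <= delta).
Proof.
move=> cptX ch delta0.
have /choice[s sP] := fun n => finite_small_cover n cptX ch delta0.
pose code := (nat * (nat * seq nat))%type.
(* (n, (a, u)) codes the itinerary u_0, u_1, ..., u_(K-1), a, a, ... of the
   iterates of h^n. *)
pose A (t : code) : set X := [set x | (0 < t.1)%N /\
  forall k, nth set0 (s t.1) (nth t.2.1 t.2.2 k) (iter (t.1 * k) h x)].
(* Numbers that code nothing are sent to the empty set. *)
exists (fun c => oapp A set0 (@choice.unpickle code c)); split.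
- move=> x n n0 [q xq].
  have [a aq] := (sP n).1 q.
  have [K _ KP] := xq _ (open_nbhs_nbhs aq).
  have /choice[u uP] : forall k, exists i, nth set0 (s n) i (iter (n * k) h x).
    move=> k; have [i [_ ix]] := (sP n).1 (iter (n * k) h x).
    by exists i.
  exists (choice.pickle ((n, (a, mkseq u K)) : code)).
  rewrite choice.pickleK; split => // k /=.
  have [kK|Kk] := ltnP k K; first by rewrite nth_mkseq.
  by rewrite (nth_default a) ?size_mkseq//; exact: KP.
- move=> c x y j; case: (choice.unpickle c) => // -[n [a u]] [/= n0 xA] [_ yA].
  (* Euclidean division of [j] by [n]: the itinerary places both points in a common set at the
     multiple of [n], and the cover controls the remaining steps, fewer than [n]. *)
  rewrite (divn_eq j n) addnC (mulnC _ n) !iterD.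
  by apply: (sP n).2 (xA _) (yA _) _; rewrite ltn_pmod.
Qed.

(** * Measurability of [Gamma] *)

Lemma ziter_continuous (X : topologicalType) (f : homeo X) (i : int) :
  continuous (ziter f i).
Proof.
by case: i => n; apply: iter_continuous;
  [exact: homeo_fun_continuous|exact: homeo_inv_continuous].
Qed.

Lemma measurable_Gamma (R : realType) (X : pmetricType R) (f : homeo X)
    (delta : R) (x : X) : measurable (Gamma f delta x : set (borel X)).
Proof.
rewrite -[X in measurable X]setCK; apply: measurableC.
apply: sub_sigma_algebra; apply: closed_openC.
rewrite (_ : Gamma f delta x =
    \bigcap_i (fun y => mdist (ziter f i x) (ziter f i y)) @^-1` `]-oo, delta]).
  apply: closed_bigI => i _.
  apply: (continuous_closedP _).1; last exact: lray_closed.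
  move=> y; apply: (@continuous_comp _ _ _ (ziter f i)).
    exact: ziter_continuous.
  exact: mdist_continuous.
apply/seteqP; split => y /= yG.
  by move=> i _ /=; rewrite in_itv/=; exact: yG.
by move=> i; have := yG i Logic.I; rewrite /= in_itv.
Qed.

(** * Heteroclinic points are negligible *)

Lemma iter_cancel (T : Type) (f g : T -> T) (n : nat) :
  cancel f g -> cancel (iter n f) (iter n g).
Proof. by move=> fK; elim: n => // n IH x; rewrite iterSr /= fK. Qed.

Lemma iter_mul_fix (T : Type) (f : T -> T) (n k : nat) (x : T) :
  iter n f x = x -> iter (k * n) f x = x.
Proof. by move=> fx; elim: k => // k IH; rewrite mulSn iterD IH. Qed.

Lemma periodic_orbit_finite (X : topologicalType) (f : homeo X) (p : X)
    (n : nat) : (0 < n)%N -> iter n f p = p ->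
  exists2 W : set X, finite_set W &
    [set ziter f i p | i in [set: int]] `<=` W /\
    (forall w, W w -> iter n f w = w /\ iter n (homeo_inv f) w = w).
Proof.
move=> n0 fp; exists [set iter i f p | i in `I_n].
  exact/finite_image/finite_II.
have iterI k : [set iter i f p | i in `I_n] (iter k f p).
  exists (k %% n)%N; first by rewrite /= ltn_mod.
  by rewrite {2}(divn_eq k n) addnC iterD iter_mul_fix.
split=> [_ [[k|k] _ <-]|_ [i _ <-]]; first exact: iterI.
  (* Writing [p] as the image under [iter k.+1 f] of a forward iterate turns a backward iterate into
     a forward one; [0 < n] keeps the subtraction exact. *)
  have pE : p = iter k.+1 f (iter (k.+1 * n - k.+1) f p).
    by rewrite -iterD subnKC ?leq_pmulr// iter_mul_fix.
  suff -> : ziter f (Negz k) p = iter (k.+1 * n - k.+1) f p by exact: iterI.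
  by rewrite [in LHS]pE; exact: iter_cancel (@homeo_funK _ f) _.
have fi : iter n f (iter i f p) = iter i f p by rewrite -iterD addnC iterD fp.
split=> //; rewrite -[in LHS]fi; apply: iter_cancel; exact: homeo_funK.
Qed.

(** The alpha-limit set is an orbit of [f], but its points are also fixed by the iterate of the
    inverse, so [finite_omega_limit_cvg] applies in both directions. *)
Lemma heteroclinic_cvg (R : realType) (X : pmetricType R) (f : homeo X)
    (x : X) :
  compact [set: X] -> heteroclinic f x ->
  (exists2 n, (0 < n)%N & exists q : X,
     iter (n * k) f x @[k --> \oo] --> q) /\
  (exists2 n, (0 < n)%N & exists q : X,
     iter (n * k) (homeo_inv f) x @[k --> \oo] --> q).
Proof.
move=> cptX [[q [m m0 fq] aq] [p [n n0 fp] op]].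
split.
  exists n => //; have [W fW [pW WP]] := periodic_orbit_finite n0 fp.
  apply: (@finite_omega_limit_cvg _ _ _ _ _ W) => //.
  - exact: homeo_fun_continuous.
  - by move=> w /WP[].
  - by rewrite op.
exists m => //; have [W fW [qW WP]] := periodic_orbit_finite m0 fq.
apply: (@finite_omega_limit_cvg _ _ _ _ _ W) => //.
- exact: homeo_inv_continuous.
- by move=> w /WP[].
- by move: aq; rewrite /alpha_limit => ->.
Qed.

(** Negligibility avoids having to show that the heteroclinic set or the cells [A a]&[B b] are
    Borel. *)
Lemma expansive_heteroclinic_negligible (R : realType) (X : pmetricType R)
    (f : homeo X) (mu : probability (borel X) R) :
  compact [set: X] -> expansive f mu -> mu.-negligible (heteroclinic f).
Proof.
move=> cptX [delta delta0 muG].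
have [A [Acover AP]] :=
  asymptotic_countable_cover cptX (@homeo_fun_continuous _ f) delta0.
have [B [Bcover BP]] :=
  asymptotic_countable_cover cptX (@homeo_inv_continuous _ f) delta0.
apply: (@negligibleS _ (borel X) _ mu (\bigcup_a \bigcup_b (A a `&` B b))).
  move=> x /(heteroclinic_cvg cptX)[[n n0 xf] [m m0 xg]].
  have [a ax] := Acover x n n0 xf; have [b bx] := Bcover x m m0 xg.
  by exists a => //; exists b.
apply: negligible_bigcup => a; apply: negligible_bigcup => b.
have [->|/set0P[x [ax bx]]] := eqVneq (A a `&` B b) set0.
  exact: negligible_set0.
(* Any point [x] of the cell can serve as centre: [A a] bounds the distance at times [j >= 0], and
   [B b] at negative times. *)
exists (Gamma f delta x); split; [exact: measurable_Gamma|exact: muG|].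
by move=> y [ay by_] [j|j]; [exact: AP ax ay|exact: BP bx by_].
Qed.

(** * Weak* density and open sets of positive measure *)

Lemma continuous_borel_measurable (R : realType) (X : pmetricType R)
    (phi : X -> R) :
  continuous phi -> measurable_fun [set: borel X] (phi : borel X -> R).
Proof.
move=> /continuousP cphi; apply: (measurability _ (RGenOpens.measurableE R)).
move=> _ [_ [a [b ->] <-]]; rewrite setTI.
by apply: sub_sigma_algebra; apply: cphi; apply: interval_open.
Qed.

Lemma open_test_integral_gt (R : realType) (X : pmetricType R)
    (phi : continuousType X R) (c : R) :
  open ([set mu | c < test_integral mu phi] : set (prob_measures X)).
Proof.
have oc : open (proj phi @^-1` `]c, +oo[ :
    set {ptws (continuousType X R) -> R}).
  by apply: open_comp => [t _|]; [exact: proj_continuous|exact: rray_open].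
have ci := @initial_continuous _ _ (@test_integral R X).
have := open_comp (fun t _ => ci t) oc.
congr open; apply/seteqP; split => mu /=; rewrite in_itv/= andbT//.
Qed.

Lemma dense_charges_open (R : realType) (X : pmetricType R)
    (P : set (prob_measures X)) (U : set X) (x : X) :
  dense P -> open U -> U x ->
  exists2 mu : probability (borel X) R, P mu & mu U != 0%E.
Proof.
move=> dP oU Ux.
have /nbhs_ballP[r /= r0 rU] : nbhs x U by exact: open_nbhs_nbhs.
(* A tent of height 1 at [x] that vanishes outside the ball of radius [r], hence outside [U]. *)
pose phi y : R := Num.max 0 (1 - mdist x y / r).
have cphi : continuous phi.
  move=> y; apply: (@continuous_max R X (cst 0) (fun y => 1 - mdist x y / r)).
    exact: cst_continuous.
  apply: cvgB; first exact: cst_continuous.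
  by apply: cvgMr_tmp; exact: mdist_continuous.
have mphi : measurable_fun [set: borel X] (EFin \o phi : borel X -> \bar R).
  by apply/measurable_EFinP; exact: continuous_borel_measurable cphi.
have phi0 y : ~ U y -> phi y = 0.
  move=> nUy; apply/max_idPl; rewrite subr_le0 ler_pdivlMr// mul1r leNgt.
  by apply/negP => xy; apply/nUy/rU; rewrite ballEmdist.
pose phic : continuousType X R := mkcts cphi.
have [||mu [/= mu0 Pmu]] := dP [set mu | 0 < test_integral mu phic].
- exists (dirac (x : borel X) : probability (borel X) R) => /=.
  rewrite /test_integral /Rintegral integral_dirac//.
  rewrite diracT mul1e /= -[phic x]/(phi x) /phi mdistxx mul0r subr0.
  by rewrite lt_max ltr01 orbT.
- exact: open_test_integral_gt.
exists mu => //; apply/eqP => muU0; move: mu0.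
rewrite /test_integral /Rintegral.
have mU : measurable (U : set (borel X)).
  by apply: sub_sigma_algebra; exact: oU.
(* If [U] were null, only its complement would contribute, and [phi] is zero there. *)
rewrite (ge0_negligible_integral _ _ mphi _ muU0)//; last first.
  by move=> y _; rewrite lee_fin /= /phi le_max lexx.
rewrite integral0_eq ?ltxx// => y [_ nUy].
by rewrite /= phi0.
Qed.

Theorem corollary3 (R : realType) (X : pmetricType R) (f : homeo X)
    (cptX : compact [set: X])
    (dense_expansive :
      dense ([set mu | expansive f mu] : set (prob_measures X))) :
  isolated [set: X] = set0 /\ interior (heteroclinic f) = set0.
Proof.
split; rewrite -subset0 => x.
- move=> [_ [V xV]]; rewrite setIT => Vx.
  (* An isolated [x] makes its singleton open, hence charged by some expansive measure, although it
     lies in the null set [Gamma f delta x]. *)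
  have ox : open [set x].
    by rewrite openE => _ ->; rewrite /interior -Vx.
  have [mu [delta delta0 muG] /eqP] :=
    dense_charges_open dense_expansive ox erefl.
  apply; apply/eqP; rewrite -measure_le0 -(muG x).
  have mx : measurable ([set x] : set (borel X)).
    by apply: sub_sigma_algebra; exact: ox.
  have mG := measurable_Gamma f delta x.
  apply: le_measure; [exact: mem_set|exact: mem_set|].
  by move=> _ -> i; rewrite mdistxx ltW.
- move=> xH.
  have oH := open_interior (heteroclinic f).
  have [mu emu /eqP] := dense_charges_open dense_expansive oH xH.
  (* The interior is open, hence Borel, so being negligible it has measure zero. *)
  apply; apply: measure_negligible.
    by apply: sub_sigma_algebra; exact: oH.
  apply: negligibleS (expansive_heteroclinic_negligible cptX emu).
  exact: interior_subset.
Qed.
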